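(* Let $(X,\rho,\mu)$ be a quasimetric measure space, $1<p<q<\infty$, $0<\alpha<1$, and set $s=\frac{pq(1-\alpha)}{pq+p-q}$. Suppose there is $C>0$ with $\mu(B(a,r))\le C r^{s}$ for all $a\in X$, $r>0$. Assume $0<\lambda_1<p/q$ and $s\lambda_1/p=\lambda_2/q$. Then $I_\alpha$ is bounded from $M^{p,\lambda_1 s}(X,\mu)$ to $M^{q,\lambda_2}(X,\mu)$.
   Context: A quasimetric measure space $(X,\rho,\mu)$: $X$ is a topological space with a complete measure $\mu$ such that compactly supported continuous functions are dense in $L^1(X,\mu)$, and $\rho:X\times X\to[0,\infty)$ satisfies: $\rho(x,y)>0$ for $x\ne y$ and $\rho(x,x)=0$; $\rho(x,y)\le a_0\rho(y,x)$ for some constant $a_0\ge1$; $\rho(x,y)\le a_1(\rho(x,z)+\rho(z,y))$ for some constant $a_1\ge1$. Balls $B(a,r)=\{x\in X:\rho(x,a)<r\}$ are measurable with $0\le\mu(B(a,r))<\infty$; every neighborhood of $x$ contains some ball $B(x,r)$; $\mu(X)=\infty$, $\mu\{a\}=0$ for all $a$, and $B(a,r_2)\setminus B(a,r_1)\neq\emptyset$ for all $a\in X$, $0<r_1<r_2<\infty$. For $0<\alpha<1$, $I_\alpha f(x)=\int_X f(y)\rho(x,y)^{\alpha-1}\,d\mu(y)$. For $\lambda\ge0$, $1\le p<\infty$, the Morrey space $M^{p,\lambda}(X,\mu)$ is the set of $\mu$-measurable $f$ with $\|f\|_{M^{p,\lambda}(X,\mu)}=\sup_{a\in X,r>0}\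big(r^{-\lambda}\int_{B(a,r)}|f(y)|^p\,d\mu(y)\big)^{1/p}<\infty$.
   Formalization: ''Bounded'' is stated as the norm inequality for I_α f; μ-measurability of I_α f is not asserted, since the hypotheses on ρ do not make y ↦ ρ(x,y) measurable, and a non-measurable integrand is integrated as a lower integral. *)

(* Defs.v *)
From HB Require Import structures.
From mathcomp Require Import all_boot all_order all_algebra.
From mathcomp Require Import all_classical all_reals all_analysis.

Set Implicit Arguments.
Unset Strict Implicit.
Unset Printing Implicit Defensive.
Import Order.TTheory GRing.Theory Num.Theory.
Import numFieldNormedType.Exports.

Local Open Scope classical_set_scope.
Local Open Scope ring_scope.

(* A type carrying both a topology and a sigma-algebra (no compatibility
   between the two is imposed, as in the paper). *)
HB.structure Definition TopMeasurable (d : measure_display) :=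
  {T of Measurable d T & Topological T}.

Section defs.
Context (d : measure_display) (X : TopMeasurable.type d) (R : realType).

Definition qball (rho : X -> X -> R) (a : X) (r : R) : set X :=
  [set x | rho x a < r].

Definition compactly_supported_continuous (g : X -> R) : Prop :=
  continuous g /\ compact (closure [set x | g x != 0]).

Definition quasimetric_measure_space
    (rho : X -> X -> R) (mu : {measure set X -> \bar R}) : Prop :=
  measure_is_complete mu /\
  (forall f : X -> R, mu.-integrable setT (EFin \o f) ->
     forall eps : R, 0 < eps ->
     exists g : X -> R, compactly_supported_continuous g /\
       mu.-integrable setT (EFin \o g) /\
       (\int[mu]_x `|(f x - g x)%:E| < eps%:E)%E) /\
  (forall x y, 0 <= rho x y) /\
  (forall x y, x != y -> 0 < rho x y) /\
  (forall x, rho x x = 0) /\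
  (exists a0 : R, 1 <= a0 /\ forall x y, rho x y <= a0 * rho y x) /\
  (exists a1 : R, 1 <= a1 /\
     forall x y z, rho x y <= a1 * (rho x z + rho z y)) /\
  (forall a r, measurable (qball rho a r)) /\
  (forall a r, (mu (qball rho a r) < +oo)%E) /\
  (forall x (N : set X), nbhs x N -> exists2 r : R, 0 < r & qball rho x r `<=` N) /\
  mu setT = +oo%E /\
  (forall a, mu [set a] = 0%E) /\
  (forall a (r1 r2 : R), 0 < r1 -> r1 < r2 ->
     qball rho a r2 `\` qball rho a r1 !=set0).

Definition frac_integral (rho : X -> X -> R) (mu : {measure set X -> \bar R})
    (alpha : R) (f : X -> R) (x : X) : \bar R :=
  (\int[mu]_y (f y * powR (rho x y) (alpha - 1))%:E)%E.

Definition morrey_norm (rho : X -> X -> R) (mu : {measure set X -> \bar R})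
    (p lambda : R) (f : X -> \bar R) : \bar R :=
  ereal_sup [set z | exists (a : X) (r : R), 0 < r /\
     z = poweR ((powR r (- lambda))%:E *
                \int[mu]_(y in qball rho a r) (poweR `|f y| p))%E p^-1].

Definition morrey_space (rho : X -> X -> R) (mu : {measure set X -> \bar R})
    (p lambda : R) : set (X -> R) :=
  [set f | measurable_fun setT f /\ (morrey_norm rho mu p lambda (EFin \o f) < +oo)%E].

End defs.

(* Main.v *)
Require Import Defs.
From HB Require Import structures.
From mathcomp Require Import all_boot all_order all_algebra finmap.
From mathcomp Require Import all_classical all_reals all_analysis.
From mathcomp Require Import measurable_realfun.
From mathcomp Require Import lra ring.
Set Implicit Arguments.
Unset Strict Implicit.
Unset Printing Implicit Defensive.
Import Order.TTheory GRing.Theory Num.Theory.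
Import numFieldNormedType.Exports.
Local Open Scope classical_set_scope.
Local Open Scope ring_scope.

(** Write [l = lambda1 s], so that [1 - alpha = s (1 - 1/p + 1/q)] and
    [lambda2 = q l / p]; let [N] be the Morrey norm of [f] and
    [H t x] the integral of [|f|^p] over the ball [B(x, t)], so [H t x <= N^p t^l].
    The kernel is dominated by a sum over the radii [t = 2r 2^k] and [2r 2^-k],
    and by Hoelder each term is at most a constant times [t^(-s/q) (H t x)^(1/p)].
    For large radii the bound on [H] makes the series geometric since [l/p < s/q].
    For small radii, [(H t x)^(1/p) <= (H t x)^(1/q) (N^p t^l)^(1/p - 1/q)]
    leaves, because [l > 0], a spare factor [t^(2e)] with
    [2e = l (1/p - 1/q) > 0]; so the q-th power of the sum is controlled
    by the sum of the [t^(q e - s) H t x], and the integral of [H t]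
    is [O(t^s)] times that of [|f|^p].

    Neither [rho] nor [frac_integral f] need be (jointly) measurable, so the last
    step cannot use Fubini: [H t] is dominated by a measurable function built on
    a countable net of centres of balls of positive measure. *)

(** * Integrals of functions that need not be measurable *)

Section lower_integral.
Context (d : measure_display) (T : measurableType d) (R : realType).
Variable mu : {measure set T -> \bar R}.
Local Open Scope ereal_scope.

(* The library integral of a nonnegative function is the supremum over the simple
   functions below it, hence monotone even for nonmeasurable functions. *)
Lemma ge0_le_integral_nomeas (D : set T) (f g : T -> \bar R) :
  (forall x, D x -> 0 <= f x) -> (forall x, D x -> f x <= g x) ->
  \int[mu]_(x in D) f x <= \int[mu]_(x in D) g x.
Proof.
move=> f0 fg.
have g0 x : D x -> 0 <= g x by move=> Dx; exact: le_trans (f0 _ Dx) (fg _ Dx).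
rewrite !ge0_integralE//; apply: le_ereal_sup => _ [h hf <-].
exists h => // x; apply: le_trans (hf x) _; rewrite /patch.
by case: ifPn => // /set_mem; exact: fg.
Qed.

(** The integral is the difference of the integrals of [f^\+] and [f^\-]; both lie between 0 and the
    integral of [g], hence so does the absolute value of their difference. If the integral of [g] is
    infinite there is nothing to prove. *)
Lemma abse_integral_le_nomeas (D : set T) (f g : T -> \bar R) :
  (forall x, D x -> `|f x| <= g x) ->
  `|\int[mu]_(x in D) f x| <= \int[mu]_(x in D) g x.
Proof.
move=> fg; rewrite integralE.
have fp : \int[mu]_(x in D) f^\+ x <= \int[mu]_(x in D) g x.
  apply: ge0_le_integral_nomeas => [x _|x Dx]; first exact: funepos_ge0.
  apply: le_trans (fg _ Dx).
  by rewrite funeposE ge_max lee_abs abse_ge0.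
have fn : \int[mu]_(x in D) f^\- x <= \int[mu]_(x in D) g x.
  apply: ge0_le_integral_nomeas => [x _|x Dx]; first exact: funeneg_ge0.
  apply: le_trans (fg _ Dx).
  by rewrite funenegE ge_max abse_ge0 andbT -abseN lee_abs.
have : 0 <= \int[mu]_(x in D) f^\+ x by apply: integral_ge0 => x _.
have : 0 <= \int[mu]_(x in D) f^\- x by apply: integral_ge0 => x _.
move=> n0 p0; have [/eqP|Gfin] := boolP (\int[mu]_(x in D) g x == +oo).
  by move=> ->; rewrite leey.
have Gy : \int[mu]_(x in D) g x < +oo by rewrite ltey.
have pfin : \int[mu]_(x in D) f^\+ x \is a fin_num.
  by rewrite ge0_fin_numE// (le_lt_trans fp).
have nfin : \int[mu]_(x in D) f^\- x \is a fin_num.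
  by rewrite ge0_fin_numE// (le_lt_trans fn).
have gfin : \int[mu]_(x in D) g x \is a fin_num.
  by rewrite ge0_fin_numE// (le_trans p0).
move: fp fn p0 n0; rewrite -(fineK pfin) -(fineK nfin) -(fineK gfin).
rewrite -EFinB abse_EFin !lee_fin => fp fn p0 n0; rewrite ler_norml; lra.
Qed.

End lower_integral.

(** * Countability of disjoint families of sets of positive measure *)

Section disjoint_countable.
Context (d : measure_display) (T : measurableType d) (R : realType).
Variable mu : {measure set T -> \bar R}.

Lemma trivIset_measure_ge_finite (I : choiceType) (E : set I) (B : I -> set T)
    (F : set T) (e : R) :
  measurable F -> (mu F < +oo)%E -> 0 < e ->
  trivIset E B -> (forall i, measurable (B i)) ->
  (forall i, E i -> (e%:E <= mu (B i `&` F))%E) -> finite_set E.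
Proof.
move=> mF Foo e0 tB mB Ee; apply: contrapT => infE.
have Ffin : mu F \is a fin_num by rewrite ge0_fin_numE.
(* More than [mu F / e] disjoint traces on [F], each of mass at least [e], would exceed [mu F]. *)
have [D DE] := @infinite_set_fset _ E (Num.truncn (fine (mu F) / e)).+1 infE.
apply/negP; rewrite -ltnNge -(ltr_nat R).
suff : (#|` D|%:R * e <= fine (mu F)).
  rewrite -ler_pdivlMr// => /le_lt_trans; apply.
  exact: truncnS_gt.
rewrite -lee_fin fineK//.
have tD : trivIset [set` D] (fun i => B i `&` F).
  apply: (sub_trivIset DE) => i j Ei Ej [x [[Bi _] [Bj _]]].
  by apply: tB => //; exists x.
apply: (@le_trans _ _ (mu (\bigcup_(i in [set` D]) (B i `&` F)))); last first.
  apply: le_measure; rewrite ?inE//.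
    by apply: fin_bigcup_measurable => // i _; exact: measurableI.
  by move=> x [i _ []].
rewrite measure_fin_bigcup//; last by move=> i _; exact: measurableI.
rewrite -fsbig_seq// big_seq.
rewrite (_ : (_ * e)%:E = (\sum_(i <- D | i \in D) e%:E)%E).
  by apply: lee_sum => i iD; apply: Ee; exact: DE.
by rewrite -big_seq sumEFin big_const_seq count_predT iter_addr_0 mulr_natl.
Qed.

(** Sort the indices by a finite-measure piece [F n] and a threshold [1 / (m + 1)] for the mass of
    the trace on it: each of these countably many classes is finite, and positivity puts every index
    in one of them. *)
Lemma trivIset_measure_gt0_countable (I : choiceType) (E : set I) (B : I -> set T) :
  sigma_finite setT mu ->
  trivIset E B -> (forall i, measurable (B i)) ->
  (forall i, E i -> (0 < mu (B i))%E) -> countable E.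
Proof.
move=> [F TF mF] tB mB Epos.
have -> : E = \bigcup_n \bigcup_m
    [set i | E i /\ (m.+1%:R^-1%:E <= mu (B i `&` F n))%E].
  apply/seteqP; split => [i Ei|i [n _ [m _ []]]//].
  have [n n0] : exists n, (0 < mu (B i `&` F n))%E.
    apply: contrapT => /forallNP H.
    suff : (mu (B i) <= 0)%E by rewrite leNgt Epos.
    have mBF k : measurable (B i `&` F k) by apply: measurableI => //; exact: (mF k).1.
    have := @measure_sigma_subadditive _ _ _ mu (B i) (fun k => B i `&` F k).
    rewrite /subset_sigma_subadditive -setI_bigcupr -TF setIT => /(_ mBF (mB i) (@subset_refl _ _)).
    rewrite eseries0// => k _ _.
    by apply/eqP; rewrite eq_le measure_ge0 andbT leNgt; exact/negP/H.
  exists n => //.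
  have fin : mu (B i `&` F n) \is a fin_num.
    rewrite ge0_fin_numE//; apply: le_lt_trans (mF n).2.
    by apply: le_measure; rewrite ?inE//; [apply: measurableI => //|]; exact: (mF n).1.
  have fn0 : 0 < fine (mu (B i `&` F n)) by rewrite -lte_fin fineK.
  exists (Num.truncn (fine (mu (B i `&` F n)))^-1) => //; split=> //.
  rewrite -[leRHS]fineK// lee_fin -[leRHS]invrK lef_pV2 ?posrE ?invr_gt0//.
  by rewrite ltW// truncnS_gt.
apply: bigcup_countable => [|n _]; first exact: countableP.
apply: bigcup_countable => [|m _]; first exact: countableP.
apply: finite_set_countable.
apply: (@trivIset_measure_ge_finite _ _ B (F n) m.+1%:R^-1) => //.
- exact: (mF n).1.
- exact: (mF n).2.
- by apply: sub_trivIset tB => i [].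
- by move=> i [].
Qed.

End disjoint_countable.

(** * Countable nets and a measurable majorant of ball integrals *)

Section quasimetric_averages.
Context (d : measure_display) (X : TopMeasurable.type d) (R : realType).
Variables (rho : X -> X -> R) (mu : {measure set X -> \bar R}) (a0 a1 : R).
Hypothesis a0_ge1 : 1 <= a0.
Hypothesis a1_ge1 : 1 <= a1.
Hypothesis rho_ge0 : forall x y, 0 <= rho x y.
Hypothesis rho_sym : forall x y, rho x y <= a0 * rho y x.
Hypothesis rho_tri : forall x y z, rho x y <= a1 * (rho x z + rho z y).
Hypothesis mball : forall a r, measurable (qball rho a r).
Hypothesis ball_fin : forall a r, (mu (qball rho a r) < +oo)%E.

Lemma qball_trans (x y z : X) (r t : R) :
  rho x z < r -> rho z y < t -> rho x y < a1 * (r + t).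
Proof.
move=> xz zy; apply: le_lt_trans (rho_tri x y z) _.
by rewrite ltr_pM2l ?(lt_le_trans _ a1_ge1)// ltrD.
Qed.

Lemma qball_sym (x y : X) (r : R) : rho x y < r -> rho y x < a0 * r.
Proof.
move=> xy; apply: le_lt_trans (rho_sym y x) _.
by rewrite ltr_pM2l// (lt_le_trans _ a0_ge1).
Qed.

Lemma qball_sigma_finite : X -> sigma_finite setT mu.
Proof.
move=> o; exists (fun n => qball rho o n%:R); last by [].
apply/seteqP; split => // x _; exists (Num.truncn (rho x o)).+1 => //.
exact: truncnS_gt.
Qed.

(* A maximal disjoint family of balls of radius t and positive measure is
   countable; its centres form a net of the set of centres of such balls. *)
Lemma countable_positive_net (t : R) :
  exists2 E : set X, countable E &
    forall x, (0 < mu (qball rho x t))%E ->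
      exists2 z, E z & rho x z < a1 * (a0 * t + t).
Proof.
pose P := [set x | (0 < mu (qball rho x t))%E].
have [E [EP tE maxE]] := ex_maximal_disjoint_subcollection (qball rho ^~ t) P.
exists E.
  have [->|/set0P[u _]] := eqVneq E set0; first exact: countable0.
  apply: (@trivIset_measure_gt0_countable _ _ _ mu _ E (qball rho ^~ t)) => //.
  exact: qball_sigma_finite.
move=> x Px; apply: contrapT => nE.
(* If the ball of [x] met that of a centre [z], then [x] would be close to [z]. So a point far from
   [E] could be added to [E], against maximality. *)
have disj z y : E z -> rho y x < t -> rho y z < t -> False.
  move=> Ez yx yz; apply: nE; exists z => //.
  exact: qball_trans (qball_sym yx) yz.
have /set0P[y yx] : qball rho x t != set0.
  by apply/eqP => x0; move: Px; rewrite /P/= x0 measure0 ltxx.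
have xE : ~ E x by move=> Ex; exact: (disj _ _ Ex yx yx).
apply: (maxE (E `|` [set x])) => //.
- split; first by move=> v Ev; left.
  by move=> /(_ x (or_intror erefl)).
- by move=> v [/EP| ->].
- move=> i j [Ei|->] [Ej|->].
  + by apply: tE.
  + by move=> [u [ui ux]]; exfalso; exact: (disj _ _ Ei ux ui).
  + by move=> [u [ux uj]]; exfalso; exact: (disj _ _ Ej ux uj).
  + by [].
Qed.

(** A discrete substitute for Fubini. The [c]-balls about the net are made disjoint; on the [i]-th
    piece [G] is the integral of [g] over a ball [D i] large enough to contain every [t]-ball
    centred in that piece. Exchanging sum and integral, [g y] is multiplied by the total mass of the
    pieces whose [D i] contains [y]; these are disjoint and lie in the one ball about [y] whose mass
    [M] bounds. *)
Lemma ball_average_majorant (t M : R) (g : X -> \bar R) :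
  let c := a1 * (a0 * t + t) in
  0 <= M ->
  (forall y, (mu (qball rho y (a1 * (c + a0 * (a1 * (t + c))))) <= M%:E)%E) ->
  measurable_fun setT g -> (forall x, 0 <= g x)%E ->
  (forall x, g x \is a fin_num) ->
  exists G : X -> \bar R, [/\ measurable_fun setT G, (forall x, 0 <= G x)%E,
    (forall x, \int[mu]_(y in qball rho x t) g y <= G x)%E &
    (\int[mu]_x G x <= M%:E * \int[mu]_x g x)%E].
Proof.
move=> c M0 muM mg g0 gfin; have [E cE netE] := countable_positive_net t.
(* Away from the net the [t]-ball is null, so [G] may vanish there. *)
have null x : (forall z, E z -> ~ rho x z < c) -> (\int[mu]_(y in qball rho x t) g y = 0)%E.
  move=> xE; apply: null_set_integral => //.
  - exact: measurable_funTS.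
  - apply/eqP; rewrite eq_le measure_ge0 andbT leNgt; apply/negP => /netE[z Ez].
    exact: xE.
move: cE => /pfcard_geP[E0|[z]].
  exists (cst 0%E); split => //.
  - by move=> x; rewrite null// => z; rewrite E0.
  - by rewrite integral0 mule_ge0//; exact: integral_ge0.
pose B i := qball rho (z i) c.
pose D i := qball rho (z i) (a1 * (t + c)).
pose E' := seqDU B.
have mE' i : measurable (E' i) by apply: seqDU_measurable => k; exact: mball.
have mD i : measurable (D i) by exact: mball.
pose w i := (\int[mu]_(y in D i) g y)%E.
have w0 i : (0 <= w i)%E by exact: integral_ge0.
have i0 (A : set X) x : (0 <= (\1_A x : R)%:E)%E by rewrite lee_fin.
have mi (A : set X) : measurable A -> measurable_fun setT (fun x => (\1_A x : R)%:E).
  by move=> mA; exact/measurable_EFinP/measurable_indic.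
exists (fun x => \sum_(i <oo) w i * (\1_(E' i) x)%:E)%E; split.
- apply: ge0_emeasurable_sum => [i x _ _|i _]; first exact: mule_ge0.
  by apply: measurable_funeM; exact: mi.
- by move=> x; apply: nneseries_ge0 => i _ _; exact: mule_ge0.
- move=> x; have [[i _ xi]|nx] := pselect ((\bigcup_i E' i) x).
    rewrite (@nneseriesD1 _ _ i)//; last by move=> k _; exact: mule_ge0.
    rewrite -[leLHS]adde0 leeD//; last first.
      by apply: nneseries_ge0 => k _ _; exact: mule_ge0.
    rewrite indicE mem_set// mule1; apply: ge0_subset_integral => //.
      exact: measurable_funTS.
    move=> y /= yx; apply: qball_trans yx _.
    exact: (@subset_seqDU _ B i).
  rewrite null; first by apply: nneseries_ge0 => k _ _; exact: mule_ge0.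
  move=> u Eu xu; apply: nx; rewrite -seqDU_bigcup_eq.
  have [i _ zi] := @surj _ _ _ _ z u Eu.
  by exists i => //; rewrite /B /qball/= zi.
- rewrite integral_nneseries//; last 2 first.
  + by move=> i; apply: measurable_funeM; exact: mi.
  + by move=> i x _; exact: mule_ge0.
  (* The [i]-th term integrates to [w i * mu (E' i)]; expanding [w i] instead brings [g] back under
     the integral. *)
  rewrite (@eq_eseriesr _ _ (fun i => \int[mu]_y (mu (E' i) * (g y * (\1_(D i) y)%:E)))%E); last first.
    move=> i _; rewrite ge0_integralZl//; last exact: mi.
    rewrite integral_indic// setIT ge0_integralZl//; last 2 first.
      by apply: emeasurable_funM => //; exact: mi.
      by move=> x _; exact: mule_ge0.
    by rewrite muleC /w [in LHS]integral_mkcond epatch_indic.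
  rewrite -integral_nneseries//; last 2 first.
  + by move=> i; apply: measurable_funeM; apply: emeasurable_funM => //; exact: mi.
  + by move=> i x _; apply: mule_ge0 => //; exact: mule_ge0.
  rewrite -ge0_integralZl//.
  apply: ge0_le_integral_nomeas => y _.
    by apply: nneseries_ge0 => i _ _; apply: mule_ge0 => //; exact: mule_ge0.
  rewrite (@eq_eseriesr _ _ (fun i => g y * (mu (E' i) * (\1_(D i) y)%:E)))%E; last first.
    by move=> i _; rewrite muleCA.
  rewrite -(fineK (gfin y)) nneseriesZl; last by move=> i _; exact: mule_ge0.
  rewrite [leLHS]muleC; apply: lee_wpmul2r; first by rewrite lee_fin fine_ge0.
  apply: le_trans (muM y).
  (* With [y] fixed, [[set x | D i y]] is the whole space or empty, so the indicator becomes an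
     intersection and countable additivity applies. *)
  rewrite (@eq_eseriesr _ _ (fun i => mu (E' i `&` [set x | D i y])))%E; last first.
    move=> i _; rewrite indicE; have [yD|yD] := pselect (D i y).
      by rewrite mem_set// mule1; congr (mu _); apply/seteqP; split => // x [].
    rewrite memNset// mule0 (_ : _ `&` _ = set0) ?measure0//.
    by apply/seteqP; split => // x [].
  have mED i : measurable (E' i `&` [set x | D i y]).
    have [yD|yD] := pselect (D i y).
      by rewrite (_ : _ `&` _ = E' i)//; apply/seteqP; split => // x [].
    by rewrite (_ : _ `&` _ = set0)//; apply/seteqP; split => // x [].
  rewrite -measure_semi_bigcup//; last 2 first.
  + move=> i j _ _ [x [[xi _] [xj _]]]; apply: (@trivIset_seqDU _ B) => //; by exists x.
  + exact: bigcup_measurable.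
  apply: le_measure; rewrite ?inE//; first exact: bigcup_measurable.
  move=> x [i _ [xi Diy]]; apply: (@qball_trans _ _ (z i)).
    exact: (@subset_seqDU _ B i).
  exact: qball_sym.
Qed.

End quasimetric_averages.

(** * Dyadic scales, geometric series and an inequality for powers of sums *)

Section inequalities.
Context (R : realType).

Lemma dyadic_ge1 (v : R) : 1 <= v -> exists k : nat, 2 ^+ k <= v < 2 ^+ k.+1.
Proof.
move=> v1; have ex : exists n, v < 2 ^+ n.
  exists (Num.truncn v).+1; apply: lt_le_trans (truncnS_gt v) _.
  by rewrite -natrX ler_nat ltnW// ltn_expl.
have := ex_minnP ex; case=> -[|k] vk mink; first by move: vk; rewrite expr0 ltNge v1.
exists k; rewrite vk andbT leNgt; apply/negP => /mink.
by rewrite ltnn.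
Qed.

(** Locate [r / u] between powers of 2 if [u <= r], and [u / r] otherwise. With [t] the radius
    found, the first case gives [t / 4 < u <= t / 2], the second [t / 2 <= u < t]. *)
Lemma dyadic_scale (r u : R) : 0 < r -> 0 < u -> exists k : nat,
  (2 * r / 2 ^+ k / 4 <= u < 2 * r / 2 ^+ k) \/
  (2 * r * 2 ^+ k / 4 <= u < 2 * r * 2 ^+ k).
Proof.
move=> r0 u0; have [ur|ru] := leP u r.
  have /dyadic_ge1[k /andP[k1 k2]] : 1 <= r / u by rewrite ler_pdivlMr// mul1r.
  have k0 : (0 : R) < 2 ^+ k by rewrite exprn_gt0.
  exists k; left; move: k1 k2; rewrite exprS ler_pdivlMr// ltr_pdivrMr// => k1 k2.
  rewrite ler_pdivrMr// ler_pdivrMr// ltr_pdivlMr//.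
  by apply/andP; split; nra.
have /dyadic_ge1[k /andP[k1 k2]] : 1 <= u / r by rewrite ler_pdivlMr// mul1r ltW.
have k0 : (0 : R) < 2 ^+ k by rewrite exprn_gt0.
exists k; right; move: k1 k2; rewrite exprS ler_pdivlMr// ltr_pdivrMr// => k1 k2.
by apply/andP; split; nra.
Qed.

Lemma geometric_eseries (z : R) : 0 <= z -> z < 1 ->
  (\sum_(k <oo) (z ^+ k)%:E = ((1 - z)^-1)%:E)%E.
Proof.
move=> z0 z1; apply/cvg_lim => //.
under eq_fun do rewrite sumEFin.
apply: cvg_EFin; first by near=> n.
have := @cvg_geometric_series R 1 z; rewrite ger0_norm// mul1r => /(_ z1).
apply: cvg_trans; apply: near_eq_cvg; near=> n => /=.
by rewrite /series/=; apply: eq_bigr => i _; rewrite /geometric/= mul1r.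
Unshelve. all: by end_near. Qed.

Lemma two_powRN_lt1 (e : R) : 0 < e -> (2 : R) `^ (- e) < 1.
Proof.
move=> e0; rewrite powRN invf_lt1 ?powR_gt0//.
by rewrite /powR pnatr_eq0/= expR_gt1 mulr_gt0// ln_gt0// ltr1n.
Qed.

Lemma near_eseries (r e : R) : 0 < r -> 0 < e ->
  (\sum_(k <oo) ((2 * r / 2 ^+ k) `^ e)%:E =
   ((2 * r) `^ e / (1 - 2 `^ (- e)))%:E)%E.
Proof.
move=> r0 e0; rewrite EFinM -geometric_eseries ?powR_ge0 ?two_powRN_lt1//.
rewrite -nneseriesZl; last by move=> k _; rewrite lee_fin exprn_ge0 ?powR_ge0.
apply: eq_eseriesr => k _; rewrite -EFinM powRM ?invr_ge0 ?exprn_ge0//; last lra.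
rewrite -powR_mulrn ?powR_ge0// -powRrM -powR_inv1 ?exprn_ge0// -powR_mulrn//.
by rewrite -!powRrM; congr (_ * 2 `^ _)%:E; lra.
Qed.

Lemma far_eseries (r e : R) : 0 < r -> 0 < e ->
  (\sum_(k <oo) ((2 * r * 2 ^+ k) `^ (- e))%:E =
   ((2 * r) `^ (- e) / (1 - 2 `^ (- e)))%:E)%E.
Proof.
move=> r0 e0; rewrite EFinM -geometric_eseries ?powR_ge0 ?two_powRN_lt1//.
rewrite -nneseriesZl; last by move=> k _; rewrite lee_fin exprn_ge0 ?powR_ge0.
apply: eq_eseriesr => k _; rewrite -EFinM powRM ?exprn_ge0//; last lra.
by rewrite -powR_mulrn ?powR_ge0// -powRrM -powR_mulrn// -!powRrM [k%:R * _]mulrC.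
Qed.

(** The sum is at most twice the larger summand; infinite values are allowed. *)
Lemma poweRD_le (u v : \bar R) (q : R) : 0 <= q -> (0 <= u)%E -> (0 <= v)%E ->
  (poweR (u + v) q <= (2 `^ q)%:E * (poweR u q + poweR v q))%E.
Proof.
move=> q0; wlog uv : u v / (u <= v)%E.
  by move=> H u0 v0; have [/H|/ltW/H] := leP u v; [|rewrite addeC [X in (_ * X)%E]addeC]; apply.
move=> u0 v0; apply: (@le_trans _ _ (poweR (2%:E * v) q)%E).
  have v2 : (0 <= 2%:E * v)%E by rewrite mule_ge0.
  apply: gt0_ler_poweR => //; rewrite ?in_itv/= ?leey ?andbT ?adde_ge0//.
  by rewrite mule_natl mule2n leeD2r.
rewrite poweRM// poweR_EFin; apply: lee_wpmul2l; first by rewrite lee_fin powR_ge0.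
by rewrite leeDr// poweR_ge0.
Qed.

End inequalities.

(** * Hoelder's inequality on a set *)

Section hoelder_on_set.
Context (d : measure_display) (T : measurableType d) (R : realType).
Variable mu : {measure set T -> \bar R}.

(** Hoelder for the pair [f \* \1_D] and [\1_D], with conjugate exponent [(1 - p^-1)^-1]; powers of
    an indicator with positive exponent are that indicator. *)
Lemma integral_norm_le_hoelder (D : set T) (f : T -> R) (p : R) :
  1 < p -> measurable D -> measurable_fun setT f ->
  (\int[mu]_(x in D) `|f x|%:E <=
   poweR (\int[mu]_(x in D) (`|f x| `^ p)%:E) p^-1 * poweR (mu D) (1 - p^-1))%E.
Proof.
move=> p1 mD mf; have p0 : 0 < p by lra.
have pV : p^-1 < 1 by rewrite invf_lt1.
have q0 : 0 < (1 - p^-1)^-1 by rewrite invr_gt0; lra.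
have m1 : measurable_fun setT (\1_D : T -> R) by exact: measurable_indic.
have mfD : measurable_fun setT (f \* \1_D) by exact: measurable_funM.
have := hoelder mu mfD m1 p0 q0; rewrite invrK => /(_ ltac:(lra)).
have one (x : T) : `|(\1_D x : R)| `^ (1 - p^-1)^-1 = \1_D x.
  rewrite indicE; case: (x \in D); rewrite ?normr1 ?powR1// normr0 powR0//.
  by rewrite gt_eqF.
rewrite unlock/= invr1 invrK poweRe1; last by apply: integral_ge0 => x _; rewrite lee_fin powR_ge0.
under [X in (X <= _)%E]eq_integral => x _.
  rewrite powRr1// -mulrA (_ : \1_D x * \1_D x = \1_D x :> R); last first.
    by rewrite indicE; case: (x \in D); rewrite ?mulr1 ?mulr0.
  rewrite normrM EFinM.
  rewrite [X in (_ * X%:E)%E]ger0_norm//.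
  over.
under [X in poweR X p^-1]eq_integral => x _.
  rewrite normrM powRM// EFinM.
  rewrite (_ : `|\1_D x| `^ p = \1_D x); last first.
    by rewrite indicE; case: (x \in D); rewrite ?normr1 ?powR1// normr0 powR0// gt_eqF.
  over.
under [X in poweR X (1 - p^-1)]eq_integral => x _ do rewrite one.
rewrite integral_indic// setIT.
rewrite [in X in _ -> X](integral_mkcond D) epatch_indic.
by rewrite [in X in _ -> X](integral_mkcond D) epatch_indic.
Qed.

End hoelder_on_set.

(** * Dyadic domination of the kernel and of the fractional integral *)

Section dyadic_radii.
Context (R : realType).
Definition near (r : R) (k : nat) := 2 * r / 2 ^+ k.
Definition far (r : R) (k : nat) := 2 * r * 2 ^+ k.

Lemma near_gt0 (r : R) k : 0 < r -> 0 < near r k.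
Proof. by move=> r0; rewrite divr_gt0 ?mulr_gt0 ?exprn_gt0. Qed.

Lemma near_le (r : R) k : 0 < r -> near r k <= 2 * r.
Proof.
move=> r0; rewrite /near ler_pdivrMr ?exprn_gt0//.
by rewrite ler_peMr ?exprn_ege1 ?ler1n// mulr_ge0// ltW.
Qed.

Lemma far_gt0 (r : R) k : 0 < r -> 0 < far r k.
Proof. by move=> r0; rewrite mulr_gt0 ?mulr_gt0 ?exprn_gt0. Qed.

(* The factor 4 absorbs both the ratio of consecutive dyadic radii and the
   reversal of the strict and large inequalities when t = 2r / 2^k. *)
Definition coef (a0 alpha t : R) := a0 `^ (1 - alpha) * (t / 4) `^ (alpha - 1).

End dyadic_radii.

Section dyadic_bound.
Context (d : measure_display) (X : TopMeasurable.type d) (R : realType).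
Variables (rho : X -> X -> R) (mu : {measure set X -> \bar R}) (a0 alpha : R).
Hypothesis a0_ge1 : 1 <= a0.
Hypothesis alpha_lt1 : alpha < 1.
Hypothesis rho_ge0 : forall x y, 0 <= rho x y.
Hypothesis rho_sym : forall x y, rho x y <= a0 * rho y x.
Hypothesis mball : forall a r, measurable (qball rho a r).

(** The exponent is negative, so [t / 4 <= rho y x] bounds the kernel by its value at [t / 4]. One
    term, at the scale of [rho y x], already dominates; the rest are nonnegative. *)
Lemma powR_rho_le (r : R) (x y : X) : 0 < r ->
  ((rho y x `^ (alpha - 1))%:E <=
   \sum_(k <oo) ((near r k / 4) `^ (alpha - 1) * \1_(qball rho x (near r k)) y)%:E +
   \sum_(k <oo) ((far r k / 4) `^ (alpha - 1) * \1_(qball rho x (far r k)) y)%:E)%E.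
Proof.
move=> r0; have e0 : alpha - 1 < 0 by rewrite subr_lt0.
have t0 (t : R) : (0 <= ((t / 4) `^ (alpha - 1) * \1_(qball rho x t) y)%:E)%E.
  by rewrite lee_fin mulr_ge0 ?powR_ge0.
have s0 (t : nat -> R) : (0 <= \sum_(k <oo)
    ((t k / 4) `^ (alpha - 1) * \1_(qball rho x (t k)) y)%:E)%E.
  by apply: nneseries_ge0 => k _ _; exact: t0.
(* By convention 0 to a nonzero power is 0, so the kernel vanishes instead of being infinite
   here. *)
have [u0|u0] := eqVneq (rho y x) 0.
  rewrite u0 powR0 ?lt_eqF//; apply: adde_ge0; [exact: (s0 (near r))|exact: (s0 (far r))].
have up : 0 < rho y x by rewrite lt_def u0 rho_ge0.
have one (t : R) : t / 4 <= rho y x < t -> 0 < t ->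
    ((rho y x `^ (alpha - 1))%:E <= ((t / 4) `^ (alpha - 1) * \1_(qball rho x t) y)%:E)%E.
  move=> /andP[tu ut] tp; rewrite indicE mem_set// mulr1 lee_fin.
  rewrite -[alpha - 1]opprK !(powRN _ (- (alpha - 1))) lef_pV2 ?posrE ?powR_gt0 ?divr_gt0//.
  by apply: ge0_ler_powR; rewrite ?nnegrE ?divr_ge0 ?rho_ge0 ?(ltW tp) ?oppr_ge0 ?(ltW e0).
have [k [ku|ku]] := dyadic_scale r0 up.
  apply: (le_trans (one _ ku _)); first by rewrite divr_gt0// mulr_gt0.
  rewrite -[leLHS]adde0 leeD//.
  rewrite (@nneseriesD1 _ _ k)//.
  by apply: leeDl; apply: nneseries_ge0 => i _ _; exact: t0.
apply: (le_trans (one _ ku _)); first by rewrite mulr_gt0// mulr_gt0.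
rewrite -[leLHS]add0e leeD//.
rewrite (@nneseriesD1 _ _ k)//.
by apply: leeDl; apply: nneseries_ge0 => i _ _; exact: t0.
Qed.

Lemma powR_rho_sym (x y : X) :
  rho x y `^ (alpha - 1) <= a0 `^ (1 - alpha) * rho y x `^ (alpha - 1).
Proof.
have [u0|u0] := eqVneq (rho x y) 0.
  by rewrite u0 powR0 ?mulr_ge0 ?powR_ge0// lt_eqF// subr_lt0.
have up : 0 < rho x y by rewrite lt_def u0 rho_ge0.
have ap : 0 < a0 := lt_le_trans ltr01 a0_ge1.
have vp : 0 < rho y x.
  by have := lt_le_trans up (rho_sym x y); rewrite pmulr_rgt0.
rewrite -[alpha - 1]opprK opprB !(powRN _ (1 - alpha)) ler_pdivlMr ?powR_gt0//.
rewrite ler_pdivrMl ?powR_gt0// -powRM ?(ltW ap) ?(ltW up)// mulrC.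
by apply: ge0_ler_powR; rewrite ?nnegrE ?mulr_ge0 ?rho_ge0 ?(ltW ap) ?subr_ge0 ?(ltW alpha_lt1)//.
Qed.

(** The integrand need not be measurable, but its dominating series of weighted ball indicators is,
    so that series may be integrated term by term. *)
Lemma frac_integral_le_dyadic (f : X -> R) (r : R) (x : X) : 0 < r ->
  measurable_fun setT f ->
  (`|frac_integral rho mu alpha f x| <=
   \sum_(k <oo) (coef a0 alpha (near r k))%:E * \int[mu]_(y in qball rho x (near r k)) `|f y|%:E +
   \sum_(k <oo) (coef a0 alpha (far r k))%:E * \int[mu]_(y in qball rho x (far r k)) `|f y|%:E)%E.
Proof.
move=> r0 mf.
pose g (t : R) y := ((coef a0 alpha t)%:E * (`|f y|%:E * (\1_(qball rho x t) y)%:E))%E.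
have g0 t y : (0 <= g t y)%E.
  by rewrite /g !mule_ge0// lee_fin ?mulr_ge0 ?powR_ge0.
have mg1 t : measurable_fun setT (fun y => `|f y|%:E * (\1_(qball rho x t) y)%:E)%E.
  apply: emeasurable_funM; apply/measurable_EFinP; last exact: measurable_indic.
  exact: measurableT_comp.
have mg t : measurable_fun setT (g t) by exact: measurable_funeM.
have int (t : nat -> R) : (\sum_(k <oo) (coef a0 alpha (t k))%:E *
    \int[mu]_(y in qball rho x (t k)) `|f y|%:E = \int[mu]_y \sum_(k <oo) g (t k) y)%E.
  rewrite integral_nneseries//; apply: eq_eseriesr => k _.
  rewrite /g ge0_integralZl//; last by rewrite lee_fin mulr_ge0 ?powR_ge0.
  by rewrite [in LHS]integral_mkcond epatch_indic.
rewrite !int -ge0_integralD//; last 4 first.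
- by move=> y _; apply: nneseries_ge0.
- by apply: ge0_emeasurable_sum.
- by move=> y _; apply: nneseries_ge0.
- by apply: ge0_emeasurable_sum.
apply: abse_integral_le_nomeas => y _.
rewrite abse_EFin normrM [X in _ * X]ger0_norm ?powR_ge0//.
apply: (@le_trans _ _ ((`|f y| * a0 `^ (1 - alpha))%:E * (rho y x `^ (alpha - 1))%:E)%E).
  by rewrite -EFinM lee_fin -mulrA ler_wpM2l//; exact: powR_rho_sym.
have c0 : (0 <= (`|f y| * a0 `^ (1 - alpha))%:E)%E by rewrite lee_fin mulr_ge0 ?powR_ge0.
apply: (le_trans (lee_wpmul2l c0 (powR_rho_le x y r0))).
have t0 (t : R) : (0 <= ((t / 4) `^ (alpha - 1) * \1_(qball rho x t) y)%:E)%E.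
  by rewrite lee_fin mulr_ge0 ?powR_ge0.
rewrite ge0_muleDr; last 2 first.
- by apply: nneseries_ge0 => k _ _; exact: t0.
- by apply: nneseries_ge0 => k _ _; exact: t0.
rewrite -!nneseriesZl//.
have eqg (t : nat -> R) k : ((`|f y| * a0 `^ (1 - alpha))%:E *
    ((t k / 4) `^ (alpha - 1) * \1_(qball rho x (t k)) y)%:E = g (t k) y)%E.
  by rewrite /g -!EFinM /coef; congr EFin; ring.
by under eq_eseriesr do rewrite eqg; under [X in (_ + X)%E]eq_eseriesr do rewrite eqg.
Qed.

End dyadic_bound.

(** * Bounds for a single dyadic term *)

Section powR_bounds.
Context (R : realType).

Lemma powRD_gt0 (t a b : R) : 0 < t -> t `^ (a + b) = t `^ a * t `^ b.
Proof. by move=> t0; rewrite powRD// (gt_eqF t0) implybT. Qed.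

Context (p q alpha C s lam a0 e : R).
Hypothesis p1 : 1 < p.
Hypothesis pq : p < q.
Hypothesis C0 : 0 < C.
Hypothesis a0_ge1 : 1 <= a0.
Hypothesis alpha_s : 1 - alpha = s * (1 - p^-1 + q^-1).
Hypothesis e_lam : e + e = lam * (p^-1 - q^-1).

Definition kernel_const := a0 `^ (1 - alpha) * 4 `^ (1 - alpha) * C `^ (1 - p^-1).

Lemma kernel_const_gt0 : 0 < kernel_const.
Proof.
by rewrite /kernel_const !mulr_gt0 ?powR_gt0 ?(lt_le_trans ltr01 a0_ge1).
Qed.

(** The relation [alpha_s] collapses the exponents: [(alpha - 1) + s * (1 - p^-1) = - (s / q)]. *)
Lemma coef_powR (t : R) : 0 < t ->
  coef a0 alpha t * (C * t `^ s) `^ (1 - p^-1) = kernel_const * t `^ (- (s / q)).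
Proof.
move=> t0; rewrite /coef /kernel_const powRM ?invr_ge0 ?(ltW t0)//.
have -> : (4 : R)^-1 `^ (alpha - 1) = 4 `^ (1 - alpha).
  by rewrite -powR_inv1// -powRrM mulN1r opprB.
rewrite powRM ?powR_ge0 ?(ltW C0)// -powRrM.
have -> : - (s / q) = (alpha - 1) + s * (1 - p^-1).
  by rewrite -(opprB 1 alpha) alpha_s; ring.
by rewrite [in RHS]powRD_gt0//; ring.
Qed.

Lemma near_term_le (t N h : R) : 0 < t -> 0 <= N -> 0 <= h -> h <= N `^ p * t `^ lam ->
  coef a0 alpha t * (h `^ p^-1 * (C * t `^ s) `^ (1 - p^-1)) <=
  kernel_const * N `^ (1 - p / q) * t `^ e * (t `^ (q * e - s) * h) `^ q^-1.
Proof.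
move=> t0 N0 h0 hN; rewrite mulrCA coef_powR//.
have p0 : 0 < p := lt_trans ltr01 p1.
have q0 : 0 < q := lt_trans p0 pq.
have pVq : 0 < p^-1 - q^-1 by rewrite subr_gt0 ltf_pV2.
have -> : h `^ p^-1 = h `^ q^-1 * h `^ (p^-1 - q^-1).
  rewrite -powRD; first by rewrite addrC subrK.
  by rewrite addrC subrK invr_eq0 gt_eqF.
have hle : h `^ (p^-1 - q^-1) <= N `^ (1 - p / q) * (t `^ e * t `^ e).
  apply: (@le_trans _ _ ((N `^ p * t `^ lam) `^ (p^-1 - q^-1))).
    by apply: ge0_ler_powR; rewrite ?nnegrE ?mulr_ge0 ?powR_ge0 ?(ltW pVq).
  rewrite powRM ?powR_ge0// -!powRrM -powRD_gt0// e_lam.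
  by rewrite (_ : p * _ = 1 - p / q)// mulrBr divff// gt_eqF.
rewrite powRM ?powR_ge0// -powRrM.
have -> : (q * e - s) * q^-1 = e + - (s / q) by field; rewrite gt_eqF.
rewrite powRD_gt0//.
have K0 : 0 <= h `^ q^-1 * (kernel_const * t `^ (- (s / q))).
  by rewrite !mulr_ge0 ?powR_ge0 ?(ltW kernel_const_gt0).
have := ler_wpM2l K0 hle.
rewrite [leLHS](_ : _ = h `^ q^-1 * h `^ (p^-1 - q^-1) * (kernel_const * t `^ (- (s / q)))); last by ring.
by move/le_trans; apply; rewrite le_eqVlt; apply/orP; left; apply/eqP; ring.
Qed.

(** At large radii the growth bound is applied to the full power of [h], which leaves only a power
    of [t]. *)
Lemma far_term_le (t N h : R) : 0 < t -> 0 <= N -> 0 <= h -> h <= N `^ p * t `^ lam ->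
  coef a0 alpha t * (h `^ p^-1 * (C * t `^ s) `^ (1 - p^-1)) <=
  kernel_const * N * t `^ (- (s / q - lam / p)).
Proof.
move=> t0 N0 h0 hN; rewrite mulrCA coef_powR//.
have p0 : 0 < p := lt_trans ltr01 p1.
have hle : h `^ p^-1 <= N * t `^ (lam / p).
  apply: (@le_trans _ _ ((N `^ p * t `^ lam) `^ p^-1)).
    by apply: ge0_ler_powR; rewrite ?nnegrE ?mulr_ge0 ?powR_ge0 ?invr_ge0 ?(ltW p0).
  by rewrite powRM ?powR_ge0// -!powRrM divff ?gt_eqF// powRr1.
rewrite opprB [lam / p - _]addrC powRD_gt0//.
have K0 : 0 <= kernel_const * t `^ (- (s / q)).
  by rewrite mulr_ge0 ?powR_ge0 ?(ltW kernel_const_gt0).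
have := ler_wpM2l K0 hle; rewrite [leLHS]mulrC.
by move/le_trans; apply; rewrite le_eqVlt; apply/orP; left; apply/eqP; ring.
Qed.

End powR_bounds.

(** Working with partial sums allows [P] to be infinite. *)
Lemma nneseries_le_mule (R : realType) (u : nat -> \bar R) (c : nat -> R) (P : \bar R) :
  (forall k, 0 <= u k)%E -> (forall k, 0 <= c k) -> (0 <= P)%E ->
  (forall k, u k <= (c k)%:E * P)%E ->
  (\sum_(k <oo) u k <= (\sum_(k <oo) (c k)%:E) * P)%E.
Proof.
move=> u0 c0 P0 uc; apply: lime_le; first exact: is_cvg_nneseries.
apply: nearW => n; apply: (@le_trans _ _ (\sum_(0 <= k < n) (c k)%:E * P)%E).
  by apply: lee_sum => k _; exact: uc.
rewrite -ge0_sume_distrl; last by move=> k _; rewrite lee_fin.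
by apply: lee_wpmul2r => //; apply: nneseries_lim_ge => k _; rewrite lee_fin.
Qed.

(** * Pointwise bound for the fractional integral *)

Section pointwise_bound.
Context (d : measure_display) (X : TopMeasurable.type d) (R : realType).
Context (rho : X -> X -> R) (mu : {measure set X -> \bar R}).
Context (p q alpha C s lam a0 e : R).
Hypothesis p1 : 1 < p.
Hypothesis pq : p < q.
Hypothesis C0 : 0 < C.
Hypothesis a0_ge1 : 1 <= a0.
Hypothesis alpha_lt1 : alpha < 1.
Hypothesis alpha_s : 1 - alpha = s * (1 - p^-1 + q^-1).
Hypothesis e_gt0 : 0 < e.
Hypothesis e_lam : e + e = lam * (p^-1 - q^-1).
Hypothesis lam_s : 0 < s / q - lam / p.
Hypothesis rho_ge0 : forall x y, 0 <= rho x y.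
Hypothesis rho_sym : forall x y, rho x y <= a0 * rho y x.
Hypothesis mball : forall a (r : R), measurable (qball rho a r).
Hypothesis mu_ball : forall a (r : R), 0 < r -> (mu (qball rho a r) <= (C * r `^ s)%:E)%E.

Context (f : X -> R) (N : R).
Hypothesis mf : measurable_fun setT f.
Hypothesis N_ge0 : 0 <= N.
Hypothesis f_growth : forall a (r : R), 0 < r ->
  (\int[mu]_(y in qball rho a r) (`|f y| `^ p)%:E <= (N `^ p * r `^ lam)%:E)%E.

Let H (x : X) (t : R) : \bar R := (\int[mu]_(y in qball rho x t) (`|f y| `^ p)%:E)%E.

Let H_ge0 x t : (0 <= H x t)%E.
Proof. by apply: integral_ge0 => y _; rewrite lee_fin powR_ge0. Qed.

Let H_fin x (t : R) : 0 < t -> H x t \is a fin_num.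
Proof.
by move=> t0; rewrite ge0_fin_numE// (le_lt_trans (f_growth x t0))// ltry.
Qed.

Let pV_le1 : p^-1 <= 1.
Proof. by rewrite invf_le1 ?(lt_trans ltr01)// ltW. Qed.

Lemma integral_norm_ball_le (x : X) (t : R) : 0 < t ->
  (\int[mu]_(y in qball rho x t) `|f y|%:E <=
   (fine (H x t) `^ p^-1 * (C * t `^ s) `^ (1 - p^-1))%:E)%E.
Proof.
move=> t0; apply: (le_trans (integral_norm_le_hoelder _ p1 _ _)) => //.
rewrite EFinM -poweR_EFin fineK ?H_fin//; apply: lee_wpmul2l; first exact: poweR_ge0.
rewrite -poweR_EFin; apply: gt0_ler_poweR => //; last exact: mu_ball.
- by rewrite subr_ge0.
- by rewrite in_itv/= measure_ge0 leey.
- by rewrite in_itv/= lee_fin mulr_ge0 ?powR_ge0 ?(ltW C0)// leey.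
Qed.

Let S (r : R) (x : X) : \bar R := (\sum_(k <oo) (near r k `^ (q * e - s))%:E * H x (near r k))%E.

Lemma frac_integral_pointwise (r : R) (x : X) : 0 < r ->
  (`|frac_integral rho mu alpha f x| <=
   (kernel_const p alpha C a0 * N `^ (1 - p / q) *
      ((2 * r) `^ e / (1 - 2 `^ (- e))))%:E * poweR (S r x) q^-1 +
   (kernel_const p alpha C a0 * N *
      ((2 * r) `^ (- (s / q - lam / p)) / (1 - 2 `^ (- (s / q - lam / p)))))%:E)%E.
Proof.
move=> r0.
have K0 : 0 < kernel_const p alpha C a0 by exact: kernel_const_gt0.
have q0 : 0 < q := lt_trans (lt_trans ltr01 p1) pq.
have c0 (t : R) : (0 <= (coef a0 alpha t)%:E)%E by rewrite lee_fin mulr_ge0 ?powR_ge0.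
have term0 t : (0 <= (coef a0 alpha t)%:E * \int[mu]_(y in qball rho x t) `|f y|%:E)%E.
  by rewrite mule_ge0//; apply: integral_ge0.
have term (t : R) : 0 < t -> ((coef a0 alpha t)%:E * \int[mu]_(y in qball rho x t) `|f y|%:E <=
    (coef a0 alpha t * (fine (H x t) `^ p^-1 * (C * t `^ s) `^ (1 - p^-1)))%:E)%E.
  by move=> t0; rewrite [leRHS]EFinM lee_wpmul2l// integral_norm_ball_le.
have Hle (t : R) : 0 < t -> fine (H x t) <= N `^ p * t `^ lam.
  by move=> t0; rewrite -lee_fin fineK ?H_fin// f_growth.
apply: (le_trans (frac_integral_le_dyadic mu a0_ge1 alpha_lt1 rho_ge0 rho_sym mball x r0 mf)).
apply: leeD.
- rewrite [X in (_ <= X * _)%E]EFinM -near_eseries// -nneseriesZl; last first.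
    by move=> k _; rewrite lee_fin powR_ge0.
  under [X in (_ <= X * _)%E]eq_eseriesr do rewrite -EFinM.
  have KN0 : 0 <= kernel_const p alpha C a0 * N `^ (1 - p / q).
    by rewrite mulr_ge0 ?powR_ge0 ?(ltW K0).
  apply: nneseries_le_mule => [k|k||k]; first exact: term0.
  - by rewrite mulr_ge0 ?powR_ge0.
  - exact: poweR_ge0.
  have t0 := near_gt0 k r0.
  have h0 : 0 <= fine (H x (near r k)) by exact: fine_ge0.
  have th0 : 0 <= near r k `^ (q * e - s) * fine (H x (near r k)).
    by rewrite mulr_ge0 ?powR_ge0.
  apply: (le_trans (term _ t0)).
  apply: (@le_trans _ _ (kernel_const p alpha C a0 * N `^ (1 - p / q) * near r k `^ e *
      (near r k `^ (q * e - s) * fine (H x (near r k))) `^ q^-1)%:E).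
    by rewrite lee_fin; apply: (near_term_le (lam := lam)) => //; exact: Hle.
  rewrite EFinM; apply: lee_wpmul2l; first by rewrite lee_fin mulr_ge0 ?powR_ge0.
  have tH0 i : (0 <= (near r i `^ (q * e - s))%:E * H x (near r i))%E.
    by rewrite mule_ge0// lee_fin powR_ge0.
  have S0 : (0 <= S r x)%E by apply: nneseries_ge0 => i _ _; exact: tH0.
  rewrite -poweR_EFin; apply: gt0_ler_poweR => //; rewrite ?in_itv/= ?leey ?andbT ?lee_fin//.
    by rewrite invr_ge0 ltW.
  rewrite EFinM fineK ?H_fin// /S (@nneseriesD1 _ _ k)//.
  by apply: leeDl; apply: nneseries_ge0 => i _ _; exact: tH0.
- rewrite [leRHS]EFinM -far_eseries// -nneseriesZl; last first.
    by move=> k _; rewrite lee_fin powR_ge0.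
  apply: lee_nneseries => [k _ _|k _]; first exact: term0.
  have t0 := far_gt0 k r0.
  apply: (le_trans (term _ t0)); rewrite -EFinM lee_fin.
  apply: far_term_le => //; [exact: fine_ge0|exact: Hle].
Qed.

End pointwise_bound.

(** * Homogeneity of the final bound in [N] and [r] *)

Section estimate_constant.
Context (R : realType).

(** In the near and the far contribution alike, the powers of [N] add up to [q] and those of [r] to
    [q * (lam / p)], so [K] depends on neither. *)
Lemma estimate_constant (p q s lam e dl kc ca cb cc za zb zc : R) :
  1 < p -> p < q -> e + e = lam * (p^-1 - q^-1) -> dl = s / q - lam / p ->
  0 < kc -> 0 < ca -> 0 < cb -> 0 < cc -> 0 < za -> 0 < zb -> 0 < zc ->
  exists2 K : R, 0 < K & forall N r : R, 0 <= N -> 0 < r ->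
    2 `^ q * ((kc * N `^ (1 - p / q) * ((2 * r) `^ e / za)) `^ q *
                (ca * (2 * r) `^ (q * e) / zb * (N `^ p * (cb * r) `^ lam)) +
              (kc * N * ((2 * r) `^ (- dl) / zc)) `^ q * (cc * r `^ s)) =
    (K * N) `^ q * r `^ (q * (lam / p)).
Proof.
move=> p1 pq elam dlE kc0 ca0 cb0 cc0 za0 zb0 zc0.
have p0 : 0 < p := lt_trans ltr01 p1.
have q0 : 0 < q := lt_trans p0 pq.
pose A := (kc * 2 `^ e / za) `^ q * (ca * 2 `^ (q * e) / zb * cb `^ lam).
pose B := (kc * 2 `^ (- dl) / zc) `^ q * cc.
have A0 : 0 < A by rewrite /A !(mulr_gt0, powR_gt0, invr_gt0).
have B0 : 0 < B by rewrite /B !(mulr_gt0, powR_gt0, invr_gt0).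
exists ((2 `^ q * (A + B)) `^ q^-1); first by rewrite powR_gt0// mulr_gt0 ?powR_gt0 ?addr_gt0.
move=> N r N0 r0; have r0' := ltW r0.
have pw0 (x y : R) : 0 <= x `^ y by exact: powR_ge0.
rewrite (powRM _ (pw0 _ _) N0) -powRrM mulVf ?gt_eqF// powRr1; last first.
  by rewrite mulr_ge0 ?ltW// ?powR_gt0// addr_gt0.
have NE : (N `^ (1 - p / q)) `^ q * N `^ p = N `^ q.
  have qE : (1 - p / q) * q + p = q by field; rewrite gt_eqF.
  by rewrite -powRrM -powRD qE// gt_eqF.
have rA : (r `^ e) `^ q * (r `^ (q * e) * r `^ lam) = r `^ (q * (lam / p)).
  rewrite -powRrM -!powRD_gt0//; congr powR.
  rewrite [e * q]mulrC addrA -mulrDr elam; field.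
  by rewrite !gt_eqF.
have rB : (r `^ (- dl)) `^ q * r `^ s = r `^ (q * (lam / p)).
  rewrite -powRrM -powRD_gt0// dlE; congr powR; field.
  by rewrite !gt_eqF.
rewrite !(powRM _ _ r0')// ?(ltW cb0)//.
have -> : kc * N `^ (1 - p / q) * (2 `^ e * r `^ e / za) =
    (kc * 2 `^ e / za) * (N `^ (1 - p / q) * r `^ e) by ring.
have -> : kc * N * (2 `^ (- dl) * r `^ (- dl) / zc) =
    (kc * 2 `^ (- dl) / zc) * (N * r `^ (- dl)) by ring.
have a1 : 0 <= kc * 2 `^ e / za by rewrite ltW// !(mulr_gt0, powR_gt0, invr_gt0).
have b1 : 0 <= kc * 2 `^ (- dl) / zc by rewrite ltW// !(mulr_gt0, powR_gt0, invr_gt0).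
rewrite (powRM q a1) ?mulr_ge0// (powRM q b1) ?mulr_ge0//.
rewrite (powRM q (pw0 _ _) (pw0 _ _)) (powRM q N0 (pw0 _ _)).
rewrite /A /B; move: NE rA rB.
(* All powers become variables tied only by [NE], [rA] and [rB]; the rest is polynomial algebra. *)
move: (2 `^ q) ((kc * 2 `^ e / za) `^ q) ((kc * 2 `^ (- dl) / zc) `^ q).
move: ((N `^ (1 - p / q)) `^ q) ((r `^ e) `^ q) ((r `^ (- dl)) `^ q).
move: (N `^ p) (N `^ q) (2 `^ (q * e)) (r `^ (q * e)) (r `^ lam) (r `^ s) (cb `^ lam).
move: (r `^ (q * (lam / p))) => rl x1 x2 x3 x4 x5 x6 x7 y1 y2 y3 z1 z2 z3 NE rA rB.
transitivity (z1 * (z2 * (ca * x3 / zb * x7) * (y1 * x1) * (y2 * (x4 * x5)) +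
    z3 * cc * x2 * (y3 * x6))); first by ring.
by rewrite NE rA rB; ring.
Qed.

End estimate_constant.

(** * Integration of the pointwise bound over a ball *)

Section local_estimate.
Context (d : measure_display) (X : TopMeasurable.type d) (R : realType).
Context (rho : X -> X -> R) (mu : {measure set X -> \bar R}).
Context (p q alpha C s lam a0 a1 e : R).
Hypothesis p1 : 1 < p.
Hypothesis pq : p < q.
Hypothesis C0 : 0 < C.
Hypothesis a0_ge1 : 1 <= a0.
Hypothesis a1_ge1 : 1 <= a1.
Hypothesis alpha_lt1 : alpha < 1.
Hypothesis alpha_s : 1 - alpha = s * (1 - p^-1 + q^-1).
Hypothesis e_gt0 : 0 < e.
Hypothesis e_lam : e + e = lam * (p^-1 - q^-1).
Hypothesis lam_s : 0 < s / q - lam / p.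
Hypothesis rho_ge0 : forall x y, 0 <= rho x y.
Hypothesis rho_sym : forall x y, rho x y <= a0 * rho y x.
Hypothesis rho_tri : forall x y z, rho x y <= a1 * (rho x z + rho z y).
Hypothesis mball : forall a (r : R), measurable (qball rho a r).
Hypothesis ball_fin : forall a r, (mu (qball rho a r) < +oo)%E.
Hypothesis mu_ball : forall a (r : R), 0 < r -> (mu (qball rho a r) <= (C * r `^ s)%:E)%E.

(** The ratio to [t] of the radius of the large ball in [ball_average_majorant]. *)
Definition dilation := a1 * (a1 * (a0 + 1) + a0 * (a1 * (1 + a1 * (a0 + 1)))).

Lemma dilation_gt0 : 0 < dilation.
Proof.
have a00 : 0 < a0 := lt_le_trans ltr01 a0_ge1.
have a10 : 0 < a1 := lt_le_trans ltr01 a1_ge1.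
by rewrite /dilation !(mulr_gt0, addr_gt0).
Qed.

Context (f : X -> R) (N : R).
Hypothesis mf : measurable_fun setT f.
Hypothesis N_ge0 : 0 <= N.
Hypothesis f_growth : forall a (r : R), 0 < r ->
  (\int[mu]_(y in qball rho a r) (`|f y| `^ p)%:E <= (N `^ p * r `^ lam)%:E)%E.

Let S (r : R) (x : X) : \bar R := (\sum_(k <oo) (near r k `^ (q * e - s))%:E *
  \int[mu]_(y in qball rho x (near r k)) (`|f y| `^ p)%:E)%E.

Lemma near_energy_le (a : X) (r : R) : 0 < r ->
  exists Phi : X -> \bar R, [/\ measurable_fun setT Phi, (forall x, 0 <= Phi x)%E,
    (forall x, rho x a < r -> (S r x <= Phi x)%E) &
    (\int[mu]_(x in qball rho a r) Phi x <=
     (C * dilation `^ s * (2 * r) `^ (q * e) / (1 - 2 `^ (- (q * e))) *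
       (N `^ p * (3 * a1 * r) `^ lam))%:E)%E].
Proof.
move=> r0.
have a10 : 0 < a1 := lt_le_trans ltr01 a1_ge1.
have q0 : 0 < q := lt_trans (lt_trans ltr01 p1) pq.
(* Near radii are at most [2 * r], so a near ball centred in the ball of radius [r] about [a] stays
   within [a1 * (2 * r + r)] of [a]; cutting [f] off outside [D] keeps these energies and makes the
   total finite. *)
pose D := qball rho a (3 * a1 * r).
pose g (x : X) : \bar R := (`|f x| `^ p * \1_D x)%:E.
have mfp : measurable_fun setT (fun x => `|f x| `^ p).
  apply: (measurableT_comp (measurable_powR p)).
  exact: measurableT_comp.
have mg : measurable_fun setT g.
  apply/measurable_EFinP; apply: measurable_funM; first exact: mfp.
  by apply: measurable_indic; exact: mball.
have g0 x : (0 <= g x)%E by rewrite lee_fin mulr_ge0 ?powR_ge0.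
have intg : (\int[mu]_x g x <= (N `^ p * (3 * a1 * r) `^ lam)%:E)%E.
  apply: le_trans (f_growth a _); last by rewrite !mulr_gt0.
  by rewrite [leRHS]integral_mkcond epatch_indic.
have M0 (t : R) : 0 <= C * (dilation * t) `^ s by rewrite mulr_ge0 ?powR_ge0 ?ltW.
have /choice[G HG] : forall k, exists G : X -> \bar R, [/\ measurable_fun setT G,
    (forall x, 0 <= G x)%E,
    (forall x, \int[mu]_(y in qball rho x (near r k)) g y <= G x)%E &
    (\int[mu]_x G x <= (C * (dilation * near r k) `^ s)%:E * \int[mu]_x g x)%E].
  move=> k; apply: (ball_average_majorant a0_ge1 a1_ge1 rho_sym rho_tri) => // y.
  rewrite (_ : a1 * _ = dilation * near r k); last by rewrite /dilation; ring.
  by apply: mu_ball; rewrite mulr_gt0 ?dilation_gt0 ?near_gt0.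
have w0 k : (0 <= (near r k `^ (q * e - s))%:E)%E by rewrite lee_fin powR_ge0.
have wG0 k x : (0 <= (near r k `^ (q * e - s))%:E * G k x)%E.
  by have [_ G0 _ _] := HG k; rewrite mule_ge0.
have mwG k : measurable_fun setT (fun x => (near r k `^ (q * e - s))%:E * G k x)%E.
  by have [mG _ _ _] := HG k; exact: measurable_funeM.
exists (fun x => \sum_(k <oo) (near r k `^ (q * e - s))%:E * G k x)%E; split.
- exact: ge0_emeasurable_sum.
- by move=> x; exact: nneseries_ge0.
- move=> x xa; apply: lee_nneseries => [k _ _|k _].
    by rewrite mule_ge0//; apply: integral_ge0 => y _; rewrite lee_fin powR_ge0.
  apply: lee_wpmul2l => //; have [_ _ + _] := HG k; move=> /(_ x); apply: le_trans.
  apply: ge0_le_integral_nomeas => y yx; first by rewrite lee_fin powR_ge0.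
  rewrite /g indicE mem_set ?mulr1// /D /qball/=.
  apply: lt_le_trans (qball_trans a1_ge1 rho_tri yx xa) _.
  rewrite [3 * a1]mulrC -mulrA ler_pM2l//.
  by rewrite (_ : 3 * r = 2 * r + r) ?lerD2r ?near_le//; ring.
- apply: (@le_trans _ _ (\int[mu]_x \sum_(k <oo) (near r k `^ (q * e - s))%:E * G k x)%E).
    apply: ge0_subset_integral => //; first exact: ge0_emeasurable_sum.
    by move=> x _; exact: nneseries_ge0.
  rewrite integral_nneseries//.
  have CK0 : 0 <= C * dilation `^ s by rewrite mulr_ge0 ?powR_ge0 ?ltW.
  apply: (@le_trans _ _ ((\sum_(k <oo) (C * dilation `^ s * near r k `^ (q * e))%:E) *
      \int[mu]_x g x)%E).
    apply: nneseries_le_mule => [k|k||k].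
    + exact: integral_ge0.
    + by rewrite mulr_ge0 ?powR_ge0.
    + exact: integral_ge0.
    + have [mG G0 _ intG] := HG k.
      rewrite ge0_integralZl//; apply: le_trans (lee_wpmul2l (w0 k) intG) _.
      rewrite muleA -EFinM; apply: lee_wpmul2r; first exact: integral_ge0.
      have t0 := near_gt0 k r0.
      rewrite lee_fin powRM ?(ltW dilation_gt0) ?(ltW t0)//.
      rewrite [leRHS](_ : _ = near r k `^ (q * e - s) * (C * (dilation `^ s * near r k `^ s)))//.
      rewrite -[in LHS](subrK s (q * e)) powRD_gt0//; ring.
  under eq_eseriesr do rewrite EFinM.
  rewrite nneseriesZl; last by move=> k _; rewrite lee_fin powR_ge0.
  rewrite near_eseries ?mulr_gt0// -EFinM [leRHS]EFinM -[in leRHS]mulrA.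
  apply: lee_wpmul2l => //; rewrite lee_fin mulr_ge0// mulr_ge0 ?powR_ge0//.
  by rewrite invr_ge0 subr_ge0 ltW// two_powRN_lt1// mulr_gt0.
Qed.

(** The [q]-th power of the pointwise bound is first replaced by a measurable function of [Phi];
    only then is linearity of the integral used. *)
Lemma frac_integral_ball_le (a : X) (r : R) : 0 < r ->
  (\int[mu]_(x in qball rho a r) poweR `|frac_integral rho mu alpha f x| q <=
   (2 `^ q *
     ((kernel_const p alpha C a0 * N `^ (1 - p / q) *
          ((2 * r) `^ e / (1 - 2 `^ (- e)))) `^ q *
        (C * dilation `^ s * (2 * r) `^ (q * e) / (1 - 2 `^ (- (q * e))) *
          (N `^ p * (3 * a1 * r) `^ lam)) +
      (kernel_const p alpha C a0 * N *
          ((2 * r) `^ (- (s / q - lam / p)) / (1 - 2 `^ (- (s / q - lam / p))))) `^ q *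
        (C * r `^ s)))%:E)%E.
Proof.
move=> r0; have [Phi [mPhi Phi0 SPhi intPhi]] := near_energy_le a r0.
have q0 : 0 < q := lt_trans (lt_trans ltr01 p1) pq.
have kc0 := kernel_const_gt0 p alpha C0 a0_ge1.
set M := (C * dilation `^ s * _ / _ * _) in intPhi *.
set u := kernel_const p alpha C a0 * N `^ (1 - p / q) * _.
set v := kernel_const p alpha C a0 * N * _.
have u0 : 0 <= u.
  rewrite /u !mulr_ge0 ?powR_ge0 ?(ltW kc0)// invr_ge0 subr_ge0 ltW//.
  exact: two_powRN_lt1.
have v0 : 0 <= v.
  rewrite /v !mulr_ge0 ?powR_ge0 ?(ltW kc0)// invr_ge0 subr_ge0 ltW//.
  exact: two_powRN_lt1.
have S0 x : (0 <= S r x)%E.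
  apply: nneseries_ge0 => k _ _; rewrite mule_ge0// ?lee_fin ?powR_ge0//.
  by apply: integral_ge0 => y _; rewrite lee_fin powR_ge0.
apply: (@le_trans _ _ (\int[mu]_(x in qball rho a r)
    ((2 `^ q)%:E * ((u `^ q)%:E * Phi x + (v `^ q)%:E)))%E).
  apply: ge0_le_integral_nomeas => x xa; first exact: poweR_ge0.
  have uS0 : (0 <= u%:E * poweR (S r x) q^-1)%E by rewrite mule_ge0 ?poweR_ge0.
  apply: (@le_trans _ _ (poweR (u%:E * poweR (S r x) q^-1 + v%:E) q)).
    apply: gt0_ler_poweR; rewrite ?in_itv/= ?leey ?andbT ?adde_ge0 ?(ltW q0)//.
    by apply: frac_integral_pointwise.
  apply: (le_trans (poweRD_le (ltW q0) uS0 _)) => //.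
  apply: lee_wpmul2l; first by rewrite lee_fin powR_ge0.
  apply: leeD => //.
  rewrite poweRM ?poweR_ge0// -poweRrM mulVf ?gt_eqF// poweRe1//.
  by apply: lee_wpmul2l; [rewrite lee_fin powR_ge0|exact: SPhi].
clear SPhi S0; clearbody M u v.
have mPhiD : measurable_fun (qball rho a r) Phi by exact: measurable_funTS.
have muPhi : measurable_fun (qball rho a r) (fun x => (u `^ q)%:E * Phi x)%E.
  exact: measurable_funeM.
have uq0 : (0 <= (u `^ q)%:E)%E by rewrite lee_fin powR_ge0.
have vq0 : (0 <= (v `^ q)%:E)%E by rewrite lee_fin powR_ge0.
have uPhi0 x : (0 <= (u `^ q)%:E * Phi x)%E by exact: mule_ge0.
have muv : measurable_fun (qball rho a r) (fun x => (u `^ q)%:E * Phi x + (v `^ q)%:E)%E.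
  exact: emeasurable_funD.
have uv0 x : (0 <= (u `^ q)%:E * Phi x + (v `^ q)%:E)%E by exact: adde_ge0.
rewrite ge0_integralZl// ?lee_fin ?powR_ge0//.
rewrite [leRHS]EFinM; apply: lee_wpmul2l; first by rewrite lee_fin powR_ge0.
rewrite ge0_integralD// ge0_integralZl// integral_cst// [leRHS]EFinD.
apply: leeD; first by rewrite [leRHS]EFinM lee_wpmul2l.
by rewrite [leRHS]EFinM lee_wpmul2l// mu_ball.
Qed.

End local_estimate.

(** * Morrey norms as growth bounds on ball integrals *)

Section morrey.
Context (d : measure_display) (X : TopMeasurable.type d) (R : realType).
Context (rho : X -> X -> R) (mu : {measure set X -> \bar R}).

(** The point [a] makes the supremum range over a nonempty set; otherwise it would be [-oo]. *)
Lemma morrey_norm_ge0 (a : X) (p lam : R) (f : X -> \bar R) :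
  (0 <= morrey_norm rho mu p lam f)%E.
Proof.
apply: (le_trans _ (ereal_sup_ubound _)); last first.
  by exists a, 1; split; [exact: ltr01|reflexivity].
exact: poweR_ge0.
Qed.

Lemma morrey_norm_growth (p lam N : R) (f : X -> \bar R) (a : X) (r : R) :
  0 < p -> 0 < r -> (morrey_norm rho mu p lam f <= N%:E)%E ->
  (\int[mu]_(y in qball rho a r) poweR `|f y| p <= (N `^ p * r `^ lam)%:E)%E.
Proof.
move=> p0 r0 fN; set I := integral _ _ _.
have I0 : (0 <= I)%E by apply: integral_ge0 => y _; exact: poweR_ge0.
have rI0 : (0 <= (r `^ (- lam))%:E * I)%E by rewrite mule_ge0// lee_fin powR_ge0.
have rI : (poweR ((r `^ (- lam))%:E * I) p^-1 <= N%:E)%E.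
  by apply: le_trans fN; apply: ereal_sup_ubound; exists a, r.
have : (poweR (poweR ((r `^ (- lam))%:E * I) p^-1) p <= poweR N%:E p)%E.
  apply: gt0_ler_poweR => //; rewrite ?in_itv/= ?leey ?andbT ?poweR_ge0 ?(ltW p0)//.
  by apply: le_trans rI; exact: poweR_ge0.
rewrite -poweRrM mulVf ?gt_eqF// poweRe1// poweR_EFin => H.
have -> : I = ((r `^ lam)%:E * ((r `^ (- lam))%:E * I))%E.
  by rewrite muleA -EFinM -powRD_gt0// subrr powRr0 mul1e.
by rewrite mulrC EFinM lee_wpmul2l// lee_fin powR_ge0.
Qed.

Lemma morrey_norm_le (p lam N : R) (f : X -> \bar R) : 0 < p -> 0 <= N ->
  (forall a (r : R), 0 < r ->
    (\int[mu]_(y in qball rho a r) poweR `|f y| p <= (N `^ p * r `^ lam)%:E)%E) ->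
  (morrey_norm rho mu p lam f <= N%:E)%E.
Proof.
move=> p0 N0 fN; apply: ge_ereal_sup => _ [a [r [r0 ->]]].
have I0 : (0 <= \int[mu]_(y in qball rho a r) poweR `|f y| p)%E.
  by apply: integral_ge0 => y _; exact: poweR_ge0.
have rl0 : (0 <= (r `^ (- lam))%:E)%E by rewrite lee_fin powR_ge0.
apply: (@le_trans _ _ (poweR (N `^ p)%:E p^-1)); last first.
  by rewrite poweR_EFin -powRrM divff ?gt_eqF// powRr1.
apply: gt0_ler_poweR; rewrite ?in_itv/= ?leey ?andbT ?mule_ge0 ?lee_fin ?powR_ge0//.
  by rewrite invr_ge0 ltW.
apply: (le_trans (lee_wpmul2l rl0 (fN a r r0))).
by rewrite -EFinM lee_fin mulrCA -powRD_gt0// addNr powRr0 mulr1.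
Qed.

End morrey.

(** * Boundedness of the fractional integral between Morrey spaces *)

Unset Implicit Arguments.

Theorem theorem3p4 (d : measure_display) (X : TopMeasurable.type d)
  (R : realType) (rho : X -> X -> R) (mu : {measure set X -> \bar R})
  (p q alpha lambda1 lambda2 C : R) :
  quasimetric_measure_space rho mu ->
  1 < p -> p < q ->
  0 < alpha -> alpha < 1 ->
  let s := p * q * (1 - alpha) / (p * q + p - q) in
  0 < C ->
  (forall (a : X) (r : R), 0 < r -> (mu (qball rho a r) <= (C * powR r s)%:E)%E) ->
  0 < lambda1 -> lambda1 < p / q ->
  s * lambda1 / p = lambda2 / q ->
  exists2 K : R, 0 < K &
    forall f : X -> R, morrey_space rho mu p (lambda1 * s) f ->
      (morrey_norm rho mu q lambda2 (frac_integral rho mu alpha f)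
       <= K%:E * morrey_norm rho mu p (lambda1 * s) (EFin \o f))%E.
Proof.
move=> [_ [_ [rho_ge0 [_ [_ [[a0 [a0_ge1 rho_sym]] [[a1 [a1_ge1 rho_tri]]
  [mball [ball_fin [_ [muT _]]]]]]]]]]] p1 pq alpha0 alpha_lt1 s C0 mu_ball l0 lpq s_l.
have p0 : 0 < p := lt_trans ltr01 p1.
have q0 : 0 < q := lt_trans p0 pq.
have den0 : 0 < p * q + p - q.
  have -> : p * q + p - q = (p - 1) * q + p by ring.
  by rewrite addr_gt0// mulr_gt0// subr_gt0.
have s0 : 0 < s by rewrite /s divr_gt0 ?mulr_gt0// subr_gt0.
have alpha_s : 1 - alpha = s * (1 - p^-1 + q^-1).
  by rewrite /s; field; rewrite !gt_eqF.
clearbody s.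
pose lam := lambda1 * s.
pose e := lam * (p^-1 - q^-1) / 2.
have e_lam : e + e = lam * (p^-1 - q^-1) by rewrite /e -splitr.
have e_gt0 : 0 < e by rewrite /e divr_gt0// !mulr_gt0// subr_gt0 ltf_pV2.
(* The decay at large radii is exactly the condition [lambda1 < p / q]. *)
have lam_s : 0 < s / q - lam / p.
  have -> : s / q - lam / p = s / p * (p / q - lambda1).
    by rewrite /lam; field; rewrite !gt_eqF.
  by rewrite mulr_gt0 ?divr_gt0// subr_gt0.
have two1 (x : R) : 0 < x -> 0 < 1 - 2 `^ (- x).
  by move=> x0; rewrite subr_gt0 two_powRN_lt1.
have dil0 := dilation_gt0 a0_ge1 a1_ge1.
have a10 : 0 < a1 := lt_le_trans ltr01 a1_ge1.
(* The constant is fixed before [f]; the arguments are the factors that occur in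
   [frac_integral_ball_le]. *)
have [K K0 HK] := estimate_constant (lam := lam) (s := s) p1 pq
  e_lam erefl (kernel_const_gt0 p alpha C0 a0_ge1)
  (mulr_gt0 C0 (powR_gt0 s dil0)) (mulr_gt0 (ltr0n R 3) a10) C0
  (two1 _ e_gt0) (two1 _ (mulr_gt0 q0 e_gt0)) (two1 _ lam_s).
exists K => // f [mf fN].
(* Infinite total measure supplies the point needed for the norm to be nonnegative. *)
have /set0P[x0 _] : [set: X] != set0.
  by apply/eqP => X0; move: muT; rewrite X0 measure0.
set norm_f := morrey_norm rho mu p (lambda1 * s) _ in fN *.
have norm_f0 : (0 <= norm_f)%E by exact: morrey_norm_ge0 x0 _ _ _.
have norm_f_fin : norm_f \is a fin_num by rewrite ge0_fin_numE.
have N0 : 0 <= fine norm_f by exact: fine_ge0.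
rewrite -(fineK norm_f_fin) -EFinM.
apply: morrey_norm_le => //; first by rewrite mulr_ge0// ltW.
move=> a r r0; have -> : lambda2 = q * (lam / p).
  by rewrite /lam mulrC [lambda1 * s]mulrC s_l divfK// gt_eqF.
rewrite -HK//; apply: frac_integral_ball_le => // b t t0.
by apply: (@morrey_norm_growth _ _ _ rho mu p lam _ (EFin \o f)) => //; rewrite fineK.
Qed.
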